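(* Let $X = \langle x_1, \ldots, x_n \rangle$, $Y = \langle y_1, \ldots, y_m \rangle$ and $P = \langle p_1, \ldots, p_r \rangle$ be sequences over an alphabet $\Sigma$ with $n, m, r \ge 1$, and suppose $Z = \langle z_1, \ldots, z_\ell \rangle$ is a constrained longest common subsequence of $X$ and $Y$ with respect to $P$. Then: 1. If $x_n = y_m = p_r$, then $z_\ell = x_n = y_m = p_r$ and $Z_{\ell-1}$ is a constrained longest common subsequence of $X_{n-1}$ and $Y_{m-1}$ with respect to $P_{r-1}$. 2. If $x_n = y_m$ and $x_n \neq p_r$, then $z_\ell = x_n = y_m$ and $Z_{\ell-1}$ is a constrained longest common subsequence of $X_{n-1}$ and $Y_{m-1}$ with respect to $P$. 3. If $x_n \neq y_m$ and $z_\ell \neq x_n$, then $Z$ is a constrained longest common subsequence of $X_{n-1}$ and $Y$ with respect to $P$. 4. If $x_n \neq y_m$ and $z_\ell \neq y_m$, then $Z$ is a constrained longest common subsequence of $X$ and $Y_{m-1}$ with respect to $P$.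
   Context: A sequence is a finite string of characters over an alphabet $\Sigma$. A subsequence of a sequence $X$ is obtained by deleting some (not necessarily contiguous) characters of $X$. A common subsequence of $X$ and $Y$ is a subsequence of both. For a sequence $X = \langle x_1, \ldots, x_n\rangle$, $X_i = \langle x_1, \ldots, x_i\rangle$ denotes its $i$-th prefix ($X_0$ is the empty sequence); similarly for $Y_j$, $P_k$, $Z_i$. Given sequences $X, Y, P$, a constrained common subsequence of $X$ and $Y$ with respect to $P$ is a common subsequence $Z$ of $X$ and $Y$ such that $P$ is a subsequence of $Z$; a constrained longest common subsequence (CLCS) of $X$ and $Y$ with respect to $P$ is a longest such sequence. *)

(* Defs.v *)
From mathcomp Require Import all_boot.

Set Implicit Arguments.
Unset Strict Implicit.
Unset Printing Implicit Defensive.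

Definition common_subseq (Sigma : eqType) (X Y Z : seq Sigma) : bool :=
  subseq Z X && subseq Z Y.

Definition constrained_common_subseq (Sigma : eqType)
    (X Y P Z : seq Sigma) : bool :=
  common_subseq X Y Z && subseq P Z.

Definition clcs (Sigma : eqType) (X Y P Z : seq Sigma) : Prop :=
  constrained_common_subseq X Y P Z /\
  forall W : seq Sigma, constrained_common_subseq X Y P W -> size W <= size Z.

(* One-based indexing: for 1 <= i <= size X this is the i-th character of X
   (so x_n is chr x0 X n with n = size X); the default x0 is only returned
   when X has no such character. *)
Definition chr (Sigma : eqType) (x0 : Sigma) (X : seq Sigma) (i : nat) : Sigma :=
  nth x0 X i.-1.

(* Main.v *)
Require Import Defs.
From mathcomp Require Import all_boot.

Set Implicit Arguments.
Unset Strict Implicit.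
Unset Printing Implicit Defensive.

(** Exchange argument on last characters. If [X] and [Y] both end in [a], a candidate for the
    shortened sequences can be extended by [a]. So an optimal [Z] must end in [a], or it could be
    lengthened, and what precedes that [a] is optimal for the shortened problem; [P] loses its last
    character exactly when that is [a] ([clcs_rcons]). If [Z] does not end in the last character of
    [X], it already embeds in the shortened [X] and stays optimal there ([clcs_drop_last]); [clcsC]
    transfers this to [Y]. *)

Section Constrained.

Variables (Sigma : eqType).
Implicit Types (X Y P Z W : seq Sigma).

Lemma subseq_rcons2 (a b : Sigma) (s t : seq Sigma) :
  subseq (rcons s a) (rcons t b) =
    if a == b then subseq s t else subseq (rcons s a) t.
Proof.
by rewrite -subseq_rev !rev_rcons /= -rev_rcons; case: eqP; rewrite subseq_rev.
Qed.

Lemma chr_size_rcons (x0 : Sigma) (s : seq Sigma) (a : Sigma) :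
  chr x0 (rcons s a) (size s).+1 = a.
Proof. by rewrite /chr nth_rcons ltnn eqxx. Qed.

Lemma clcsC X Y P Z : clcs X Y P Z -> clcs Y X P Z.
Proof.
rewrite /clcs /constrained_common_subseq /common_subseq.
case=> + maxZ; rewrite andbC [subseq Z X && _]andbC andbC => ZP.
by split=> // W; rewrite [subseq W Y && _]andbC => /maxZ.
Qed.

(** Shrinking [X] only removes competitors, so an optimum that survives is still an optimum. *)
Lemma clcs_subseq X X' Y P Z :
  subseq X' X -> subseq Z X' -> clcs X Y P Z -> clcs X' Y P Z.
Proof.
rewrite /clcs /constrained_common_subseq /common_subseq.
move=> sX'X sZX' [/andP[/andP[_ ->] ->] maxZ]; split; first by rewrite sZX'.
move=> W /andP[/andP[sWX' sWY] sPW]; apply: maxZ.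
by rewrite (subseq_trans sWX' sX'X) sWY.
Qed.

Lemma clcs_drop_last X Y P Z (a z : Sigma) :
  clcs (rcons X a) Y P (rcons Z z) -> z <> a -> clcs X Y P (rcons Z z).
Proof.
move=> Zopt /eqP/negPf neq_za; apply: clcs_subseq (Zopt).
  exact: subseq_rcons.
by case: Zopt => /andP[/andP[+ _] _] _; rewrite subseq_rcons2 neq_za.
Qed.

(* The hypothesis on [P] and [P'] covers both the case where the last character
   of [P] is [a] (drop it) and the case where it is not (keep [P]). *)
Lemma clcs_rcons X Y P P' Z (a z : Sigma) :
    (forall W, subseq P (rcons W a) = subseq P' W) ->
    clcs (rcons X a) (rcons Y a) P (rcons Z z) ->
  z = a /\ clcs X Y P' Z.
Proof.
move=> PP' [/andP[/andP[sZX sZY] sPZ] maxZ].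
(* Appending [a] to [W] gives a competitor of [rcons Z z]; cancelling the two last characters bounds
   [W] by [Z]. *)
have extend W : subseq W X -> subseq W Y -> subseq P (rcons W a) ->
    size W <= size Z.
  move=> sWX sWY sPW; have := maxZ (rcons W a).
  rewrite /constrained_common_subseq /common_subseq !subseq_rcons2 eqxx.
  by rewrite sWX sWY sPW !size_rcons => /(_ isT).
have eq_za : z = a.
  apply/eqP; apply: contraT => /negPf neq_za.
  move: sZX sZY; rewrite !subseq_rcons2 neq_za => sZX sZY.
  (* With [z] different from [a], [rcons Z z] itself can be extended by [a], giving the absurd bound
     [(size Z).+1 <= size Z]. *)
  have := extend _ sZX sZY (subseq_trans sPZ (subseq_rcons _ _)).
  by rewrite size_rcons ltnn.
move: sZX sZY sPZ; rewrite eq_za !subseq_rcons2 eqxx PP' => sZX sZY sPZ.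
split=> //; split.
  by rewrite /constrained_common_subseq /common_subseq sZX sZY.
by move=> W /andP[/andP[sWX sWY] sPW]; apply: extend; rewrite ?PP'.
Qed.

End Constrained.

Theorem theorem1 (Sigma : eqType) (x0 : Sigma) (n m r l : nat)
    (X Y P Z : seq Sigma)
    (sizeX : size X = n) (sizeY : size Y = m)
    (sizeP : size P = r) (sizeZ : size Z = l)
    (n_ge1 : 1 <= n) (m_ge1 : 1 <= m) (r_ge1 : 1 <= r)
    (Z_clcs : clcs X Y P Z) :
  [/\ chr x0 X n = chr x0 Y m /\ chr x0 Y m = chr x0 P r ->
        [/\ chr x0 Z l = chr x0 X n, chr x0 X n = chr x0 Y m,
            chr x0 Y m = chr x0 P r &
            clcs (take (n - 1) X) (take (m - 1) Y) (take (r - 1) P)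
                 (take (l - 1) Z)],
      chr x0 X n = chr x0 Y m /\ chr x0 X n <> chr x0 P r ->
        [/\ chr x0 Z l = chr x0 X n, chr x0 X n = chr x0 Y m &
            clcs (take (n - 1) X) (take (m - 1) Y) P (take (l - 1) Z)],
      chr x0 X n <> chr x0 Y m /\ chr x0 Z l <> chr x0 X n ->
        clcs (take (n - 1) X) Y P Z
    & chr x0 X n <> chr x0 Y m /\ chr x0 Z l <> chr x0 Y m ->
        clcs X (take (m - 1) Y) P Z].
Proof.
subst n m r l.
(* [Z] contains the nonempty [P], so it has a last character and [chr x0 Z l] is not the default. *)
have : 0 < size Z.
  by case: Z_clcs => /andP[_ /size_subseq] sPZ _; apply: leq_trans sPZ.
case/lastP: X n_ge1 Z_clcs => // X a _; case/lastP: Y m_ge1 => // Y b _.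
case/lastP: P r_ge1 => // P p _; case/lastP: Z => // Z z Z_clcs _.
rewrite !size_rcons !chr_size_rcons !subn1 /= -!cats1 !take_size_cat // !cats1.
split.
- case=> eq_ab eq_bp; move: Z_clcs; rewrite eq_ab eq_bp.
  by case/(@clcs_rcons _ _ _ _ P) => // W; rewrite subseq_rcons2 eqxx.
- case=> eq_ab /eqP neq_ap; move: Z_clcs; rewrite -eq_ab.
  (* As [p] differs from [a], a final [a] cannot match the end of the pattern, which is kept
     whole. *)
  case/(@clcs_rcons _ _ _ _ (rcons P p)) => // W.
  by rewrite subseq_rcons2 eq_sym (negPf neq_ap).
- by case=> _ /(clcs_drop_last Z_clcs).
- by case=> _ /(clcs_drop_last (clcsC Z_clcs))/clcsC.
Qed.
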